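(* Fix the 300W_LP coordinate system (image plane equal to the $XY$-plane), and suppose an image contains a human head whose intrinsic rotation in this system is $R\in SO(3)$. Write $D=\begin{bmatrix}-1&0&0\\0&1&0\\0&0&1\end{bmatrix}$ and $V=\begin{bmatrix}1&0&0\\0&-1&0\\0&0&1\end{bmatrix}$. Then the head rotations associated with the following transformations of the image are: 1. Horizontal flipping (across the vertical $Y$-axis): $R_{\mathrm{flip}}(\pi/2)=D\,R\,D$. 2. Vertical flipping (across the horizontal $X$-axis): $R_{\mathrm{flip}}(0)=V\,R\,D$. 3. Flipping about both axes: $R_{bf}=D\,V\,R\,D\,D=\begin{bmatrix}-1&0&0\\0&-1&0\\0&0&1\end{bmatrix}R$. 4. Symmetrical flipping about $L_{\pi/4}$: $R_{\mathrm{flip}}(\pi/4)=\begin{bmatrix}0&1&0\\1&0&0\\0&0&1\end{bmatrix}R\,D$. 5. Rotation of the image by $\pi/4$ counter-clockwise: $R_{\mathrm{rot}}(\pi/4)=\begin{bmatrix}\cos(\pi/4)&-\sin(\pi/4)&0\\ \sin(\pi/4)&\cos(\pi/4)&0\\0&0&1\end{bmatrix}R$.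
   Context: A rotation matrix is $R\in SO(3)$, acting on column vectors from the left; its $j$-th column is the position, in the fixed (extrinsic) coordinates, of the $j$-th axis of the coordinate system attached to the head (intrinsic system), which coincides with the extrinsic one when $R=I_3$. 300W_LP coordinate system: as seen by the viewer of the image, the extrinsic $X$-axis points to the right, the $Y$-axis points up, and the $Z$-axis points out of the image towards the viewer. The image lies in the $XY$-plane. When $R=I_3$ the head is frontal: the head's $X$-axis points towards the left side of the face, its $Y$-axis upwards, its $Z$-axis out of the nose. $L_\theta$ is the line through the origin in the $XY$-plane obtained by rotating the $X$-axis by the angle $\theta$ counter-clockwise, and $f_\theta$ is the reflection of the $XY$-plane across $L_\theta$ (2D flipping about $L_\theta$). Horizontal flipping is $f_{\pi/2}$ and vertical flipping is $f_0$. The image shows the orthogonal projections $\pi(c_1),\pi(c_2),\pi(c_3)$ of the columns $c_1,c_2,c_3$ of $R$ to the $XY$-plane, where $\pi(x,y,z)=(x,y)$. Head rotation associated with a flip: flipping an image produces a mirror image of the head, in which left and right sides of the face are interchanged, so the displayed intrinsic $X$-axis has its direction reversed. Accordingly $R_{\mathrm{flip}}(\theta)$ is the matrix $R'\in SO(3)$ with columns $c_1',c_2',c_3'$ satisfying $\pi(c_1')=-f_\theta(\pi(c_1))$, $\pi(c_2')=f_\theta(\pi(c_2))$, $\pi(c_3')=f_\theta(\pi(c_3))$. Flipping about both axes means performing the vertical flip and then the horizontal flip; $R_{bf}$ is the head rotation obtained by passing from $R$ to the head rotation associated with the vertical flip, and then from that rotation to the one associated with the horizontal flip. Head rotation associated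 with rotating the image counter-clockwise by $\phi$: $R_{\mathrm{rot}}(\phi)$ is the matrix $R'\in SO(3)$ with columns $c_j'$ satisfying $\pi(c_j')=\rho_\phi(\pi(c_j))$ for $j=1,2,3$, where $\rho_\phi$ is the counter-clockwise rotation of the $XY$-plane by $\phi$ about the origin. *)

(* Defs.v *)
From mathcomp Require Import all_boot all_order all_algebra.
From mathcomp Require Import reals trigo.
Set Implicit Arguments.
Unset Strict Implicit.
Unset Printing Implicit Defensive.
Import Order.TTheory GRing.Theory Num.Theory.
Local Open Scope ring_scope.

(* The file works in the 300W_LP coordinate system: seen by the viewer of the
   image, the extrinsic X-axis points right, Y points up and Z points out of
   the image, so that counter-clockwise in the image is the usual positive
   orientation of the XY-plane. *)

Definition mx_of_rows (R : realType) (m n : nat) (s : seq (seq R)) :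
  'M[R]_(m, n) := \matrix_(i < m, j < n) nth 0 (nth [::] s i) j.

Definition is_SO3 (R : realType) (A : 'M[R]_3) : Prop :=
  A^T *m A = 1%:M /\ \det A = 1.

(* Orthogonal projection to the XY-plane: (x, y, z) |-> (x, y). *)
Definition proj_xy (R : realType) (v : 'cV[R]_3) : 'cV[R]_2 :=
  \col_(i < 2) v (widen_ord (leqnSn 2) i) 0.

Definition dot2 (R : realType) (u v : 'cV[R]_2) : R := \sum_(i < 2) u i 0 * v i 0.

(* Counter-clockwise rotation of the XY-plane by the angle phi. *)
Definition rot_plane (R : realType) (phi : R) (v : 'cV[R]_2) : 'cV[R]_2 :=
  mx_of_rows 2 2 [:: [:: cos phi; - sin phi];
                     [:: sin phi;   cos phi]] *m v.

(* Reflection across the line spanned by u (meaningful for u != 0): twice the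
   orthogonal projection of v to that line, minus v. *)
Definition reflect_across (R : realType) (u v : 'cV[R]_2) : 'cV[R]_2 :=
  (2 * (dot2 v u / dot2 u u)) *: u - v.

(* The line L_theta is spanned by the unit vector of the X-axis rotated by
   theta. *)
Definition line_dir (R : realType) (theta : R) : 'cV[R]_2 :=
  rot_plane theta (mx_of_rows 2 1 [:: [:: 1]; [:: 0]]).

Definition flip_plane (R : realType) (theta : R) (v : 'cV[R]_2) : 'cV[R]_2 :=
  reflect_across (line_dir theta) v.

(* A' is a head rotation associated with flipping about L_theta the image of a
   head with rotation A.  The first column carries a minus sign because the
   mirror image interchanges the left and right sides of the face.  The columns
   are numbered from 0, and 0, 1, 2 are here elements of 'I_3. *)
Definition is_flip_rotation (R : realType) (theta : R) (A A' : 'M[R]_3) : Prop :=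
  [/\ is_SO3 A',
      proj_xy (col 0 A') = - flip_plane theta (proj_xy (col 0 A)),
      proj_xy (col 1 A') = flip_plane theta (proj_xy (col 1 A)) &
      proj_xy (col 2 A') = flip_plane theta (proj_xy (col 2 A))].

(* The vertical flip (theta = 0) first, then the horizontal flip
   (theta = pi / 2). *)
Definition is_bothflip_rotation (R : realType) (A A' : 'M[R]_3) : Prop :=
  exists B : 'M[R]_3,
    is_flip_rotation 0 A B /\ is_flip_rotation (pi / 2) B A'.

Definition is_image_rotation (R : realType) (phi : R) (A A' : 'M[R]_3) : Prop :=
  is_SO3 A' /\
  forall j : 'I_3, proj_xy (col j A') = rot_plane phi (proj_xy (col j A)).

(* Main.v *)
(* A rotation is determined by the XY-projections of its columns, i.e. by its
   first two rows: for rotations A and B sharing them, A B^T is orthogonal, has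
   determinant 1 and agrees with the identity in its first two rows, so it is
   the identity.  Reflection across L_theta acts on the plane by the matrix
   [[cos 2t, sin 2t], [sin 2t, - cos 2t]], of determinant -1, and reversing the
   head's X-axis is right multiplication by D, also of determinant -1; hence
   the flipped head is the rotation M R D, with M this matrix extended by 1. *)

Require Import Defs.
From mathcomp Require Import all_boot all_order all_algebra.
From mathcomp Require Import reals trigo.
From mathcomp Require Import ring.
Set Implicit Arguments.
Unset Strict Implicit.
Unset Printing Implicit Defensive.
Import Order.TTheory GRing.Theory Num.Theory.
Local Open Scope ring_scope.

Definition plane_mx (R : realType) (M : 'M[R]_2) : 'M[R]_3 :=
  block_mx M 0 0 (1%:M : 'M_1).

Definition reflection_mx (R : realType) (theta : R) : 'M[R]_2 :=
  mx_of_rows 2 2 [:: [:: cos (theta *+ 2);   sin (theta *+ 2)];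
                     [:: sin (theta *+ 2); - cos (theta *+ 2)]].

Definition negate_X_mx (R : realType) : 'M[R]_3 :=
  mx_of_rows 3 3 [:: [:: -1; 0; 0]; [:: 0; 1; 0]; [:: 0; 0; 1]].

Lemma ord3P (P : 'I_3 -> Prop) : P 0 -> P 1 -> P 2 -> forall i, P i.
Proof.
move=> P0 P1 P2 [[|[|[|//]]] hi].
- by rewrite (_ : Ordinal hi = 0) //; apply: val_inj.
- by rewrite (_ : Ordinal hi = 1) //; apply: val_inj.
- by rewrite (_ : Ordinal hi = 2) //; apply: val_inj.
Qed.

Lemma ord2P (P : 'I_2 -> Prop) : P 0 -> P 1 -> forall i, P i.
Proof.
move=> P0 P1 [[|[|//]] hi].
- by rewrite (_ : Ordinal hi = 0) //; apply: val_inj.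
- by rewrite (_ : Ordinal hi = 1) //; apply: val_inj.
Qed.

Lemma SO3_proj_inj (R : realType) (A B : 'M[R]_3) :
  is_SO3 A -> is_SO3 B ->
  (forall j, proj_xy (col j A) = proj_xy (col j B)) -> A = B.
Proof.
move=> [AtA detA] [BtB detB] eqAB.
have BBt : B *m B^T = 1%:M by apply: mulmx1C.
(* [C] is kept opaque so that [mxE] does not expand its entries into sums. *)
have [C defC] : exists C, C = A *m B^T by exists (A *m B^T).
have eq01 (i : 'I_3) : (i < 2)%N -> forall j, A i j = B i j.
  move=> lti j; move/matrixP/(_ (Ordinal lti) 0): (eqAB j).
  by rewrite !mxE; congr (A _ _ = B _ _); apply: val_inj.
have rowC (i : 'I_3) : (i < 2)%N -> forall j, C i j = (i == j)%:R.
  move=> lti j; have -> : (i == j)%:R = (1%:M : 'M[R]_3) i j by rewrite mxE.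
  rewrite -BBt defC !mxE.
  by apply: eq_bigr => k _; rewrite eq01.
have CCt : C *m C^T = 1%:M.
  by rewrite defC trmx_mul trmxK mulmxA -(mulmxA A) BtB mulmx1; apply: mulmx1C.
(* Row [j] of [C] is a unit vector, so the entry [(j, 2)] of [C *m C^T] reduces to [C 2 j]. *)
have C2 (j : 'I_3) : (j < 2)%N -> C 2 j = 0.
  move=> ltj; have := congr1 (fun X : 'M_3 => X j 2) CCt.
  rewrite !mxE (bigD1 j) //= rowC // eqxx mul1r mxE big1 ?addr0.
    by move=> ->; case: eqP ltj => // ->.
  by move=> k kj; rewrite rowC // eq_sym (negPf kj) mul0r.
have C22 : C 2 2 = 1.
  have : \det C = 1 by rewrite defC det_mulmx det_tr detA detB mulr1.
  (* The known rows make [C] lower triangular with diagonal 1, 1, [C 2 2]. *)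
  rewrite det_trig; last first.
    apply/is_trig_mxP; apply: ord3P => j ltij.
    - by rewrite rowC //; case: eqP ltij => // <-.
    - by rewrite rowC //; case: eqP ltij => // <-.
    - by case: j ltij => -[|[|[|]]].
  rewrite big_ord_recr big1 /= ?mul1r => [<-|i _]; last first.
    by rewrite rowC ?eqxx ?(ltn_ord i).
  by congr (C _ _); apply: val_inj.
have C1 : C = 1%:M.
  apply/matrixP; apply: ord3P => j; rewrite mxE.
  - by rewrite rowC.
  - by rewrite rowC.
  - by move: j; apply: ord3P; rewrite ?C22 // C2.
by rewrite -[A]mulmx1 -BtB mulmxA -defC C1 mul1mx.
Qed.

Lemma proj_xy_plane_mx (R : realType) (M : 'M[R]_2) (v : 'cV[R]_3) :
  proj_xy (plane_mx M *m v) = M *m proj_xy v.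
Proof.
(* Reading 3 as 2 + 1, the projection is the upper block, which opens the way to block
   multiplication. *)
have projE (w : 'cV[R]_3) : proj_xy w = usubmx (w : 'cV_(2 + 1)).
  apply/matrixP => i j; rewrite !mxE (ord1 j).
  by congr (w _ _); apply: val_inj.
rewrite !projE -{1}[v](@vsubmxK R 2 1 1) /plane_mx (@mul_block_col R 2 1 2 1 1).
by rewrite col_mxKu mul0mx addr0.
Qed.

(** Common form of all the cases: [M] moves the image and [S] relabels the head's axes. Each may be
    improper, but the determinant condition makes the product a rotation; uniqueness is
    [SO3_proj_inj]. *)
Lemma SO3_proj_mulP (R : realType) (M : 'M[R]_2) (S A A' : 'M[R]_3) :
  M^T *m M = 1%:M -> S^T *m S = 1%:M -> \det M * \det S = 1 -> is_SO3 A ->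
  (is_SO3 A' /\
   forall j, proj_xy (col j A') = M *m proj_xy (col j (A *m S))) <->
  A' = plane_mx M *m A *m S.
Proof.
move=> MtM StS detMS [AtA detA].
have hB : is_SO3 (plane_mx M *m A *m S).
  split; last first.
    rewrite !det_mulmx detA mulr1 /plane_mx (@det_ublock R 2 1).
    by rewrite det1 mulr1.
  have PtP : (plane_mx M)^T *m plane_mx M = 1%:M.
    rewrite /plane_mx (@tr_block_mx R 2 1 2 1) (@mulmx_block R 2 1 2 1 2 1).
    rewrite !trmx0 trmx1 !mul0mx !mulmx0 mul1mx MtM addr0 !add0r.
    by rewrite -(@scalar_mx_block R 2 1).
  by rewrite !trmx_mul -!mulmxA (mulmxA _ (plane_mx M)) PtP mul1mx
     (mulmxA _ A) AtA mul1mx.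
have colB j : proj_xy (col j (plane_mx M *m A *m S)) =
              M *m proj_xy (col j (A *m S)).
  by rewrite -proj_xy_plane_mx !colE !mulmxA.
split=> [[hA' colA']|->]; last by [].
by apply: SO3_proj_inj => // j; rewrite colA' colB.
Qed.

Lemma det_mx22 (R : comNzRingType) (M : 'M[R]_2) :
  \det M = M 0 0 * M 1 1 - M 0 1 * M 1 0.
Proof.
rewrite (expand_det_row _ 0) !big_ord_recl big_ord0 /cofactor !det_mx11 !mxE /=.
rewrite !addr0 expr0 expr1 mul1r mulN1r mulrN.
by congr (M _ _ * M _ _ - M _ _ * M _ _); apply: val_inj.
Qed.

(** Passes from the block form, suited to multiplication, to the explicit matrices of the
    theorem. *)
Lemma plane_mxE (R : realType) (a b c d : R) :
  plane_mx (mx_of_rows 2 2 [:: [:: a; b]; [:: c; d]]) =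
  mx_of_rows 3 3 [:: [:: a; b; 0]; [:: c; d; 0]; [:: 0; 0; 1]].
Proof.
apply/matrixP => i j; rewrite !mxE; case: splitP => i' /= ->.
  rewrite !mxE; case: splitP => j' /= ->; rewrite !mxE; last first.
    by rewrite (ord1 j'); case: i' => -[|[|]].
  by case: i' => -[|[|]] //= _; case: j' => -[|[|]].
rewrite (ord1 i') !mxE; case: splitP => j' /= ->; rewrite !mxE.
  by case: j' => -[|[|]].
by rewrite (ord1 j').
Qed.

Lemma image_rotationP (R : realType) (phi : R) (A A' : 'M[R]_3) :
  is_SO3 A ->
  is_image_rotation phi A A' <->
  A' = mx_of_rows 3 3 [:: [:: cos phi; - sin phi; 0];
                          [:: sin phi;   cos phi; 0];
                          [:: 0;         0;       1]] *m A.
Proof.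
(* The head's axes keep their directions, so [S] is the identity. *)
move=> hA; rewrite -plane_mxE -[X in _ = X]mulmx1 -SO3_proj_mulP //.
- by rewrite mulmx1.
- apply/matrixP; apply: ord2P; apply: ord2P;
    rewrite !mxE !big_ord_recr big_ord0 /= !mxE /= -?(cos2Dsin2 phi); ring.
- by rewrite trmx1 mulmx1.
- by rewrite det1 mulr1 det_mx22 !mxE /= -(cos2Dsin2 phi); ring.
Qed.

Lemma line_dirE (R : realType) (theta : R) :
  line_dir theta = mx_of_rows 2 1 [:: [:: cos theta]; [:: sin theta]].
Proof.
apply/matrixP => i j; rewrite (ord1 j) /line_dir /rot_plane; move: i.
by apply: ord2P; rewrite !mxE !big_ord_recr big_ord0 /= !mxE /=; ring.
Qed.

(** For the unit vector u = (cos t, sin t) the reflection is 2 u u^T - 1, and the double-angle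
    formulas give its entries. *)
Lemma flip_planeE (R : realType) (theta : R) (v : 'cV[R]_2) :
  flip_plane theta v = reflection_mx theta *m v.
Proof.
have cs := cos2Dsin2 theta.
have dotE (u w : 'cV[R]_2) : dot2 u w = u 0 0 * w 0 0 + u 1 0 * w 1 0.
  rewrite /dot2 !big_ord_recr big_ord0 /= add0r.
  by congr (u _ _ * w _ _ + u _ _ * w _ _); apply: val_inj.
have uu : dot2 (line_dir theta) (line_dir theta) = 1.
  by rewrite line_dirE dotE !mxE /= -[RHS]cs; ring.
rewrite /flip_plane /reflect_across uu divr1 /reflection_mx mulr2n cosD sinD.
rewrite line_dirE; apply/matrixP => i j; rewrite (ord1 j) {j uu}; move: i.
have s2 : sin theta ^+ 2 = 1 - cos theta ^+ 2 by rewrite -cs; ring.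
(* The indices left by [big_ord_recr] agree with 0 and 1 only in value, and [ring] would treat the
   entries as distinct atoms. *)
have v0 : v (widen_ord (leqnSn 1) ord_max) 0 = v 0 0.
  by congr (v _ _); apply: val_inj.
have v1 : v ord_max 0 = v 1 0 by congr (v _ _); apply: val_inj.
apply: ord2P; rewrite !mxE dotE !big_ord_recr big_ord0 /= !mxE /= v0 v1.
  by ring: s2.
by ring: s2.
Qed.

Lemma flip_rotationP (R : realType) (theta : R) (A A' : 'M[R]_3) :
  is_SO3 A ->
  is_flip_rotation theta A A' <->
  A' = plane_mx (reflection_mx theta) *m A *m negate_X_mx R.
Proof.
move=> hA; have cs := cos2Dsin2 (theta *+ 2).
rewrite -SO3_proj_mulP //.
(* The boolean exponent puts the sign of the first column and the unchanged other two into one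
   formula, matching the quantified condition of [SO3_proj_mulP]. *)
- have colD j : col j (A *m negate_X_mx R) = (-1) ^+ (j == 0) *: col j A.
    apply/matrixP => i k; rewrite !mxE !big_ord_recr big_ord0 !mxE /=.
    have a0 : A i (widen_ord (leqnSn 2) (widen_ord (leqnSn 1) ord_max)) = A i 0.
      by congr (A _ _); apply: val_inj.
    have a1 : A i (widen_ord (leqnSn 2) ord_max) = A i 1.
      by congr (A _ _); apply: val_inj.
    have a2 : A i ord_max = A i 2 by congr (A _ _); apply: val_inj.
    rewrite a0 a1 a2; move: j; apply: ord3P => /=; ring.
  have projZ a (w : 'cV[R]_3) : proj_xy (a *: w) = a *: proj_xy w.
    by apply/matrixP => i j; rewrite !mxE.
  rewrite /is_flip_rotation !flip_planeE; split.
    move=> [hA' h0 h1 h2]; split=> //.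
    apply: ord3P; rewrite colD projZ -scalemxAr.
    + by rewrite expr1 scaleN1r.
    + by rewrite expr0 scale1r.
    + by rewrite expr0 scale1r.
  move=> [hA' h]; split=> //; rewrite h colD projZ -scalemxAr.
  + by rewrite expr1 scaleN1r.
  + by rewrite expr0 scale1r.
  + by rewrite expr0 scale1r.
- apply/matrixP; apply: ord2P; apply: ord2P;
    rewrite !mxE !big_ord_recr big_ord0 /= !mxE /= -?cs; ring.
- apply/matrixP; apply: ord3P; apply: ord3P;
    rewrite !mxE !big_ord_recr big_ord0 /= !mxE /=; ring.
(* Both determinants are -1. *)
- rewrite det_mx22 det_trig.
    by rewrite !big_ord_recr big_ord0 !mxE /= -[RHS]cs; ring.
  apply/is_trig_mxP; apply: ord3P; apply: ord3P; by rewrite !mxE.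
Qed.

Theorem corollary11p5p1 (R : realType) (A : 'M[R]_3) (hA : is_SO3 A) :
  let D : 'M[R]_3 := mx_of_rows 3 3 [:: [:: -1; 0; 0];
                                        [::  0; 1; 0];
                                        [::  0; 0; 1]] in
  let V : 'M[R]_3 := mx_of_rows 3 3 [:: [:: 1;  0; 0];
                                        [:: 0; -1; 0];
                                        [:: 0;  0; 1]] in
  [/\ forall A' : 'M[R]_3,
        is_flip_rotation (pi / 2) A A' <-> A' = D *m A *m D,
      forall A' : 'M[R]_3,
        is_flip_rotation 0 A A' <-> A' = V *m A *m D,
      (forall A' : 'M[R]_3,
        is_bothflip_rotation A A' <-> A' = D *m V *m A *m D *m D) /\
      D *m V *m A *m D *m D =
        mx_of_rows 3 3 [:: [:: -1;  0; 0];
                           [::  0; -1; 0];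
                           [::  0;  0; 1]] *m A,
      forall A' : 'M[R]_3,
        is_flip_rotation (pi / 4) A A' <->
        A' = mx_of_rows 3 3 [:: [:: 0; 1; 0];
                                [:: 1; 0; 0];
                                [:: 0; 0; 1]] *m A *m D &
      forall A' : 'M[R]_3,
        is_image_rotation (pi / 4) A A' <->
        A' = mx_of_rows 3 3 [:: [:: cos (pi / 4); - sin (pi / 4); 0];
                                [:: sin (pi / 4);   cos (pi / 4); 0];
                                [:: 0;              0;            1]] *m A].
Proof.
move=> D V.
(* In diagonal form, products of these matrices are computed entrywise by [mul_diag_mx]. *)
have diagE (a b c : R) :
  mx_of_rows 3 3 [:: [:: a; 0; 0]; [:: 0; b; 0]; [:: 0; 0; c]] =
  diag_mx (mx_of_rows 1 3 [:: [:: a; b; c]]).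
  by apply/matrixP; apply: ord3P; apply: ord3P; rewrite !mxE.
have DD : D *m D = 1%:M.
  rewrite /D diagE; apply/matrixP; apply: ord3P; apply: ord3P;
    rewrite mul_diag_mx !mxE /=; ring.
have half : pi / 2 *+ 2 = pi :> R by rewrite mulr2n -splitr.
have quarter : pi / 4 *+ 2 = pi / 2 :> R by rewrite mulr2n; field.
(* Stated for an arbitrary rotation, since the double flip applies it to the vertically flipped
   head. *)
have hflip A0 (hA0 : is_SO3 A0) A' :
  is_flip_rotation (pi / 2) A0 A' <-> A' = D *m A0 *m D.
  by rewrite flip_rotationP // plane_mxE half cospi sinpi opprK.
have vflip A' :
  is_flip_rotation 0 A A' <-> A' = V *m A *m D.
  by rewrite flip_rotationP // plane_mxE mul0rn cos0 sin0.
split=> //.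
- exact: hflip.
- split.
    move=> A'; split.
      move=> [B [hB]]; have [sB _ _ _] := hB.
      by move/(hflip _ sB) => ->; move/vflip: hB => ->; rewrite !mulmxA.
    move=> ->; exists (V *m A *m D).
    have hB : is_flip_rotation 0 A (V *m A *m D) by apply/vflip.
    by split=> //; have [sB _ _ _] := hB; apply/(hflip _ sB); rewrite !mulmxA.
  (* The head's X-axis is reversed twice, so the two right factors cancel and only the diagonal
     product [D *m V] remains. *)
  rewrite -mulmxA DD mulmx1; congr (_ *m _).
  rewrite /D /V !diagE; apply/matrixP; apply: ord3P; apply: ord3P;
    rewrite mul_diag_mx !mxE /=; ring.
- by move=> A'; rewrite flip_rotationP // plane_mxE quarter cos_pihalf
     sin_pihalf oppr0.
- by move=> A'; exact: image_rotationP.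
Qed.
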